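(* Let $\ell$, $r$ and $n$ be positive integers, and let $P=[x_1,\ldots,x_\ell]\,[y_1,\ldots,y_r]_n$ be a position of Simple Chopsticks. If $\ell>r$ and Left moves first in $P$, then Left has a winning strategy. Symmetrically, if $\ell<r$ and Right moves first in $P$, then Right has a winning strategy.
   Context: Simple Chopsticks. Fix a positive integer $n$, the finger count. A position $[x_1,\ldots,x_\ell]\,[y_1,\ldots,y_r]_n$ consists of a finite non-decreasing sequence $(x_1,\ldots,x_\ell)$ of integers in $\{1,\ldots,n\}$ (Left's hands) and a finite non-decreasing sequence $(y_1,\ldots,y_r)$ of integers in $\{1,\ldots,n\}$ (Right's hands); either list may be empty. Left's moves: for any $i\in\{1,\ldots,\ell\}$, $j\in\{1,\ldots,r\}$, replace $y_j$ by $y_j+x_i$ (re-sorting), removing the entry from Right's list if $y_j+x_i>n$. Right's moves: for any $i,j$, replace $x_i$ by $x_i+y_j$, removing it if $x_i+y_j>n$. No moves are available when either list is empty. Normal play: a player who cannot move on their turn loses. *)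

(* Defs.v *)
From mathcomp Require Import all_boot.

Set Implicit Arguments.
Unset Strict Implicit.
Unset Printing Implicit Defensive.

Inductive player := Left | Right.

Definition opponent (p : player) : player :=
  match p with Left => Right | Right => Left end.

(* Left's hands, then Right's hands. *)
Definition position : Type := (seq nat * seq nat)%type.

Definition is_hands (n : nat) (s : seq nat) : bool :=
  sorted leq s && all (fun z => 1 <= z <= n) s.

Definition is_position (n : nat) (P : position) : bool :=
  is_hands n P.1 && is_hands n P.2.

(* Add a fingers to the j-th hand of s (counted from 0); the hand disappears if
   it then exceeds n. *)
Definition tap (n a j : nat) (s : seq nat) : seq nat :=
  let b := nth 0 s j + a in
  sort leq (take j s ++ (if b <= n then [:: b] else [::]) ++ drop j.+1 s).

(* For both players, a move is a pair (i, j) of an index i of a Left hand and an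
   index j of a Right hand; the player decides which of the two hands is hit. *)
Definition legal (P : position) (m : nat * nat) : bool :=
  (m.1 < size P.1) && (m.2 < size P.2).

Definition play (n : nat) (p : player) (m : nat * nat) (P : position) :
    position :=
  match p with
  | Left => (P.1, tap n (nth 0 P.1 m.1) m.2 P.2)
  | Right => (tap n (nth 0 P.2 m.2) m.1 P.1, P.2)
  end.

Definition strategy : Type := position -> nat * nat.

(* Player p, to move in P and following s, always has a move available and,
   whatever the opponent does, reaches after finitely many turns a position in
   which the opponent is to move and cannot: the second premise of the
   constructor is vacuous exactly there, and being inductive excludes infinite
   plays. *)
Inductive wins_moving_first (n : nat) (p : player) (s : strategy) :
    position -> Prop :=
| WinsMovingFirst (P : position) :
    legal P (s P) ->
    (forall m : nat * nat, legal (play n p (s P) P) m ->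
       wins_moving_first n p s
         (play n (opponent p) m (play n p (s P) P))) ->
    wins_moving_first n p s P.

Definition has_winning_strategy_moving_first (n : nat) (p : player)
    (P : position) : Prop :=
  exists s : strategy, wins_moving_first n p s P.

(* Main.v *)
(** If Left can kill a hand, she kills Right's largest one with her largest one
    and is then ahead by two before Right's reply. Otherwise no two opposing
    hands add up to more than [n]; call this quiet. If hitting Right's smallest
    hand with Left's smallest one keeps the position quiet, Left plays it, and
    Right cannot kill in reply. If not, Left hits Right's smallest hand with her
    largest one: the resulting hand can be killed by every Left hand. Should
    Right use it to kill, Left kills it in return, and what remains is a quiet
    position with one hand less on each side and Right to move. *)

Require Import Defs.
From mathcomp Require Import all_boot.
From mathcomp Require Import zify.

Set Implicit Arguments.
Unset Strict Implicit.
Unset Printing Implicit Defensive.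

(** Deleting by index and deleting by value with [rem] may pick different occurrences but leave the
    same multiset, so [tap] can be handled up to permutation. *)
Lemma take_drop_perm_rem (s : seq nat) j :
  j < size s -> perm_eq (take j s ++ drop j.+1 s) (rem (nth 0 s j) s).
Proof.
move=> hj; rewrite -(perm_cons (nth 0 s j)).
rewrite perm_sym; apply: perm_trans (_ : perm_eq s _).
  by rewrite perm_sym; apply/perm_to_rem/mem_nth.
rewrite -{1}(cat_take_drop j s) (drop_nth 0 hj).
by rewrite perm_catC /= perm_cons perm_catC.
Qed.

Lemma tap_live_perm n a j s : j < size s -> nth 0 s j + a <= n ->
  perm_eq (tap n a j s) (nth 0 s j + a :: rem (nth 0 s j) s).
Proof.
move=> hj live; rewrite /tap live perm_sort perm_catCA /= perm_cons.
exact: take_drop_perm_rem.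
Qed.

Lemma tap_kill_perm n a j s : j < size s -> n < nth 0 s j + a ->
  perm_eq (tap n a j s) (rem (nth 0 s j) s).
Proof.
move=> hj kill; rewrite /tap leqNgt kill perm_sort /=.
exact: take_drop_perm_rem.
Qed.

Lemma size_tap_live n a j s : j < size s -> nth 0 s j + a <= n ->
  size (tap n a j s) = size s.
Proof.
move=> hj live; rewrite (perm_size (tap_live_perm hj live)) /=.
by rewrite size_rem ?mem_nth // prednK //; apply: leq_ltn_trans hj.
Qed.

Lemma size_tap_kill n a j s : j < size s -> n < nth 0 s j + a ->
  size (tap n a j s) = (size s).-1.
Proof.
by move=> hj kill; rewrite (perm_size (tap_kill_perm hj kill)) size_rem ?mem_nth.
Qed.

Lemma mem_tap n a j s z : j < size s -> z \in tap n a j s ->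
  z \in s \/ z = nth 0 s j + a /\ z <= n.
Proof.
move=> hj; case: (leqP (nth 0 s j + a) n) => h.
  rewrite (perm_mem (tap_live_perm hj h)) inE => /orP[/eqP -> | /mem_rem]; auto.
by rewrite (perm_mem (tap_kill_perm hj h)) => /mem_rem; left.
Qed.

Lemma is_hands_tap n a j s :
  j < size s -> is_hands n s -> is_hands n (tap n a j s).
Proof.
move=> hj /andP[_ /allP hs]; apply/andP; split.
  exact: sort_sorted leq_total _.
apply/allP => z /(mem_tap hj)[/hs // | [-> ->]].
by rewrite andbT; have /andP[z0 _] := hs _ (mem_nth 0 hj); apply: ltn_addr.
Qed.

(** Termination measure. A hand [z <= n] weighs at least 1, so a kill lowers the sum just as an
    enlargement does. *)
Definition room (n : nat) (s : seq nat) : nat := \sum_(z <- s) (n.+1 - z).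

Lemma room_tap n a j s : j < size s -> is_hands n s -> 0 < a ->
  room n (tap n a j s) < room n s.
Proof.
move=> hj /andP[_ /allP hs] a0.
have /andP[z0 zn] := hs _ (mem_nth 0 hj).
rewrite /room [ltnRHS](perm_big _ (perm_to_rem (mem_nth 0 hj))) big_cons.
case: (leqP (nth 0 s j + a) n) => h.
  by rewrite (perm_big _ (tap_live_perm hj h)) big_cons /= ltn_add2r; lia.
by rewrite (perm_big _ (tap_kill_perm hj h)) /= -[ltnLHS]add0n ltn_add2r subn_gt0 ltnS.
Qed.

Lemma hand_nth_gt0 n s j : is_hands n s -> j < size s -> 0 < nth 0 s j.
Proof. by move=> /andP[_ /allP hs] /(mem_nth 0) /hs /andP[]. Qed.

Lemma sorted_nth0_le s z : sorted leq s -> z \in s -> nth 0 s 0 <= z.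
Proof.
move=> hs zs; rewrite -(nth_index 0 zs).
apply: (sorted_leq_nth leq_trans leqnn 0 hs) => //; rewrite inE ?index_mem //.
by case: s zs {hs}.
Qed.

Lemma sorted_le_nth_last s z :
  sorted leq s -> z \in s -> z <= nth 0 s (size s).-1.
Proof.
move=> hs zs; rewrite -{1}(nth_index 0 zs).
have hi : index z s < size s by rewrite index_mem.
by apply: (sorted_leq_nth leq_trans leqnn 0 hs); rewrite ?inE; lia.
Qed.

Definition quiet (n : nat) (P : position) : Prop :=
  forall u v : nat, u \in P.1 -> v \in P.2 -> u + v <= n.

(** Hands are sorted: index 0 is a smallest one, the last index a largest one. The second test
    bounds the largest sum that the enlarged Right hand can form with a Left hand. *)
Definition left_strategy (n : nat) : strategy := fun P =>
  let i := (size P.1).-1 in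
  let j := (size P.2).-1 in
  if n < nth 0 P.1 i + nth 0 P.2 j then (i, j)
  else if nth 0 P.1 i + nth 0 P.1 0 + nth 0 P.2 0 <= n then (0, 0)
  else (i, 0).

(* Positions met when Left is to move: the second alternative is the one after
   Right has killed with the hand [v] enlarged by Left's sacrifice. *)
Definition left_invariant (n : nat) (P : position) : Prop :=
  size P.2 < size P.1 \/
  0 < size P.1 /\ size P.2 <= size P.1 /\
  exists v ys, [/\ perm_eq P.2 (v :: ys),
    forall u, u \in P.1 -> n < u + v & quiet n (P.1, ys)].

(** [Q] is the position after Left's hit. If it is quiet, Right cannot kill; otherwise a lead of two
    survives the loss of one hand. *)
Lemma reply_keeps_lead n (Q : position) m :
  legal Q m -> quiet n Q /\ size Q.2 < size Q.1 \/ (size Q.2).+1 < size Q.1 ->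
  left_invariant n (play n Right m Q).
Proof.
move=> /andP[h1 h2] hQ; left => /=.
case: (leqP (nth 0 Q.1 m.1 + nth 0 Q.2 m.2) n) => h.
  by rewrite size_tap_live //; lia.
rewrite size_tap_kill //; case: hQ => [[q _] | ]; last lia.
by have := q _ _ (mem_nth 0 h1) (mem_nth 0 h2); rewrite leqNgt h.
Qed.

Lemma left_invariant_step n (P : position) m :
  is_position n P -> 0 < size P.2 -> left_invariant n P ->
  legal (play n Left (left_strategy n P) P) m ->
  left_invariant n (play n Right m (play n Left (left_strategy n P) P)).
Proof.
case: P => x y /andP[/= hx hy] y0 inv.
have [sx sy] : sorted leq x /\ sorted leq y by case/andP: hx; case/andP: hy.
have x0 : 0 < size x by case: inv => [/= /(leq_ltn_trans (leq0n _)) | []].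
have lx : (size x).-1 < size x by lia.
have ly : (size y).-1 < size y by lia.
rewrite /left_strategy /=; case: ltnP => [kill | nokill].
  move=> lm; apply: reply_keeps_lead lm _ => /=.
  have kill' : n < nth 0 y (size y).-1 + nth 0 x (size x).-1 by lia.
  rewrite size_tap_kill //; case: inv => [/= | [_ [/= le_yx]]]; first by right; lia.
  move=> [v [ys [pv dead q]]]; left; split; last by lia.
  have vy : v \in y by rewrite (perm_mem pv) mem_head.
  (* By quietness, Left's largest hand cannot kill a hand of [ys], so the hand being killed is
     [v]. *)
  have last_y : nth 0 y (size y).-1 = v.
    have := mem_nth 0 ly; rewrite (perm_mem pv) inE => /orP[/eqP // | hw].
    by have := q _ _ (mem_nth 0 lx) hw; move=> /=; lia.
  move=> u w /= ux; rewrite (perm_mem (tap_kill_perm ly kill')) last_y => hw.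
  apply: (q u w ux).
  suff p : perm_eq (rem v y) ys by rewrite -(perm_mem p).
  by rewrite -(perm_cons v) perm_sym -(permPl pv) perm_to_rem.
have q : quiet n (x, y).
  move=> u w /= ux wy.
  by have := sorted_le_nth_last sx ux; have := sorted_le_nth_last sy wy; lia.
(* The second alternative of the invariant offers Left a kill, against [q]. *)
have lt_yx : size y < size x.
  case: inv => [// | [_ [_ [v [ys [/= pv dead _]]]]]].
  have vy : v \in y by rewrite (perm_mem pv) mem_head.
  by have := q _ _ (mem_nth 0 lx) vy; have := dead _ (mem_nth 0 lx); move=> /=; lia.
case: leqP => [calm | crowded] /= lm.
  apply: reply_keeps_lead lm _; left => /=.
  have live : nth 0 y 0 + nth 0 x 0 <= n.
    by have := q _ _ (mem_nth 0 x0) (mem_nth 0 y0); move=> /=; lia.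
  rewrite size_tap_live //; split=> // u w /= ux.
  rewrite (perm_mem (tap_live_perm y0 live)) inE => /orP[/eqP -> | /mem_rem].
    by have := sorted_le_nth_last sx ux; lia.
  exact: q.
have live : nth 0 y 0 + nth 0 x (size x).-1 <= n.
  by have := q _ _ (mem_nth 0 lx) (mem_nth 0 y0); move=> /=; lia.
case/andP: lm => /= hi hj; have sy' := size_tap_live y0 live.
set y' := tap n _ _ _ in hj sy' *.
case: (leqP (nth 0 x m.1 + nth 0 y' m.2) n) => h.
  by left => /=; rewrite size_tap_live // sy'.
right => /=; rewrite size_tap_kill //; split; first by lia.
split; first by lia.
(* The hand enlarged by the sacrifice, and Right's untouched hands. *)
exists (nth 0 y 0 + nth 0 x (size x).-1), (rem (nth 0 y 0) y).
split; first exact: tap_live_perm.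
  (* A surviving Left hand is at least the old smallest one, so [crowded] applies. *)
  move=> u; rewrite (perm_mem (tap_kill_perm hi h)) => /mem_rem /(sorted_nth0_le sx).
  lia.
move=> u w /=; rewrite (perm_mem (tap_kill_perm hi h)) => /mem_rem ux /mem_rem.
exact: q.
Qed.

Lemma left_strategy_legal n (P : position) :
  0 < size P.1 -> 0 < size P.2 -> legal P (left_strategy n P).
Proof.
move=> h1 h2; have [p1 p2] : (size P.1).-1 < size P.1 /\ (size P.2).-1 < size P.2.
  by lia.
by rewrite /left_strategy /legal; case: ifP => _; last case: ifP => _; apply/andP.
Qed.

Lemma left_strategy_wins n (P : position) :
  is_position n P -> 0 < size P.2 -> left_invariant n P ->
  wins_moving_first n Left (left_strategy n) P.
Proof.
(* Left's move and Right's reply each lower the total room strictly. *)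
have [k] := ubnP (room n P.1 + room n P.2).
elim: k P => [|k IH] P; first by rewrite ltn0.
move=> ltk hP y0 inv.
have x0 : 0 < size P.1 by case: inv => [/(leq_ltn_trans (leq0n _)) | []].
apply: WinsMovingFirst (left_strategy_legal n x0 y0) _ => m lm.
have := left_invariant_step hP y0 inv lm.
case/andP: hP => h1 h2; case/andP: (left_strategy_legal n x0 y0) => l1 l2.
case/andP: lm => /= m1 m2.
have h2' := is_hands_tap (nth 0 P.1 (left_strategy n P).1) l2 h2.
have r1 := room_tap m1 h1 (hand_nth_gt0 h2' m2).
have r2 := room_tap l2 h2 (hand_nth_gt0 h1 l1).
apply: IH => /=; first by lia.
  by apply/andP; split=> //; apply: is_hands_tap.
(* The legal reply [m] uses a Right hand, so Right still has one. *)
exact: leq_ltn_trans m2.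
Qed.

Definition swap_pair (A B : Type) (P : A * B) : B * A := (P.2, P.1).

(** The rules are symmetric: exchanging the two lists, and the two indices of each move, turns
    Left's moves into Right's. *)
Lemma wins_moving_first_swap n s (P : position) :
  wins_moving_first n Left s P ->
  wins_moving_first n Right (fun Q => swap_pair (s (swap_pair Q))) (swap_pair P).
Proof.
elim=> {}P lP _ IH; rewrite /swap_pair in IH *; constructor=> /=.
  by case: P lP {IH} => x y; rewrite /legal /= andbC.
case: P lP IH => x y /= lP IH [i j] lm.
by apply: (IH (j, i)); move: lm; rewrite /legal /= andbC.
Qed.

Theorem theorem3p1 (l r n : nat) (x : l.-tuple nat) (y : r.-tuple nat)
    (hl : 0 < l) (hr : 0 < r) (hn : 0 < n)
    (hP : is_position n (tval x, tval y)) :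
  (r < l -> has_winning_strategy_moving_first n Left (tval x, tval y)) /\
  (l < r -> has_winning_strategy_moving_first n Right (tval x, tval y)).
Proof.
split=> h.
  exists (left_strategy n); apply: left_strategy_wins => //=.
    by rewrite size_tuple.
  by left; rewrite /= !size_tuple.
eexists; apply: (@wins_moving_first_swap n (left_strategy n) (tval y, tval x)).
apply: left_strategy_wins => /=; last by left; rewrite /= !size_tuple.
  by move: hP; rewrite /is_position andbC.
by rewrite size_tuple.
Qed.
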